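(* Let $X={\mathbb R}^{n+1}$, let $Y={\mathbb R}^{n+1}\times{\mathbb R}$, and let $P_{\mathcal L}$ be the trivial bundle over ${\mathbb R}^{n+1}$ with fiber ${\mathbb R}^{n+2}$. In the case that the action of the group ${\mathcal G}$ on $P_{\mathcal L}$ is the lifted action $\eta_{P_{\mathcal L}}$, the momentum mappings $P^\mu$ defined by $\xi_{P_{\mathcal L}}\lrcorner\,\omega^{(\mu)}=dP^\mu(\xi_{P_{\mathcal L}})$ are the components of the Hamiltonian Noether current $\tilde{j}^1(\phi)^*J^{\mathcal H}(\xi)$, and hence the conservation law $\frac{\partial P^\mu}{\partial x^\mu}=0$ (sum over $\mu$) is contained in the covariant Hamiltonian version of Noether's theorem.
   Context: Coordinates on $X={\mathbb R}^{n+1}$ are $x^\mu$, $\mu=1,\dots,n,0$; $d^{n+1}x=dx^1\wedge\dots\wedge dx^n\wedge dx^0$ and $d^nx_\mu=\partial_\mu\lrcorner\,d^{n+1}x$, where $\lrcorner$ is interior product. $Y$ has the trivial connection, and the fields have no explicit dependence on time or space. The Lagrangian density is ${\mathcal L}=L(\phi,\phi_\mu)\,d^{n+1}x$, $\phi_\mu=\partial\phi/\partial x^\mu$. The covariant Legendre transformation ${\mathbb F}{\mathcal L}$ sends $(x,\phi,\phi_\mu)$ to $(x,\phi,p,p^\mu)$ with $p^\mu=\partial L/\partial\phi_\mu$, $p=L-p^\mu\phi_\mu$. ${\mathcal L}$ is regular if ${\mathbb F}{\mathcal L}$ is a diffeomorphism of the first jet bundle $J^1(Y)$ onto its image $P_{\mathcal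 L}$, a smooth manifold, which has coordinates $(x^\mu,\phi,p^\mu)$. The Hamiltonian density is ${\mathcal H}=H\,d^{n+1}x$ with $H=p^\mu\phi_\mu-L$, regarded as a function on the fiber ${\mathbb R}^{n+2}$. On $P_{\mathcal L}$, $\Theta_{\mathcal H}=p^\mu d\phi\wedge d^nx_\mu-H\,d^{n+1}x$ and $\Omega_{\mathcal H}=-d\Theta_{\mathcal H}$. For a section $\phi$ of $Y$, $\tilde{j}^1(\phi)={\mathbb F}{\mathcal L}\circ j^1(\phi)$, where $j^1(\phi)$ is the first jet of $\phi$; it is a Hamiltonian system (section) for ${\mathcal H}$ if $\tilde{j}^1(\phi)^*(U\lrcorner\,\Omega_{\mathcal H})=0$ for all $U\in T(P_{\mathcal L})$. Bridges' forms: $\omega^{(\mu)}$ are the $n+1$ degenerate $2$-forms on the fiber ${\mathbb R}^{n+2}$ for which the Hamiltonian system is written $\omega^{(\mu)}\big(\partial\tilde{j}^1(\phi)/\partial x^\mu,U\big)=-dH(\tilde{j}^1(\phi))\cdot U$ (sum over $\mu$), given in coordinates by $dp^\mu\wedge d\phi$ (no sum). Bridges' conservation law: if $dH\cdot\xi_{P_{\mathcal L}}=0$ for all $\xi_{P_{\mathcal L}}$ in the Lie algebra ${\mathfrak g}$ of the group ${\mathcal G}$ acting on ${\mathbb R}^{n+2}$, and $\xi_{P_{\mathcal L}}\lrcorner\,\omega^{(\mu)}=dP^\mu(\xi_{P_{\mathcal L}})$ for each $\mu$ and all $\xi_{P_{\mathcal L}}\in{\mathfrak g}$, then $\partial P^\mu/\partial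 x^\mu=0$. Here the exterior derivative $d$ defining $P^\mu$ is taken along the fiber. Lifted action: ${\mathcal G}$ acts on $Y$ by bundle automorphisms $\eta_Y$ covering the identity $\eta_X$ of $X$ (all of the group action is along the fiber), with generator $\xi\,\partial/\partial\phi$. Its prolongation to $J^1(Y)$ is $\eta_{J^1(Y)}(\gamma)=T\eta_Y\circ\gamma\circ T\eta_X^{-1}$, and the lifted action on $P_{\mathcal L}$ is $\eta_{P_{\mathcal L}}={\mathbb F}{\mathcal L}\circ\eta_{J^1(Y)}\circ{\mathbb F}{\mathcal L}^{-1}$, with generator $\xi_{P_{\mathcal L}}$ given in coordinates by $(0,\xi,-p^\mu\,\partial\xi/\partial\phi)$. The covariant momentum mapping $J^{\mathcal H}(\xi)$ is the restriction to $P_{\mathcal L}$ of $\xi_Z\lrcorner\,\Theta$, where $\Theta=p^\mu d\phi\wedge d^nx_\mu+p\,d^{n+1}x$ is the canonical form on the space $Z$ with coordinates $(x^\mu,\phi,p,p^\mu)$ and $\xi_Z$ generates the canonical lift $z\mapsto(\eta_Y^{-1})^*z$. Here $J^{\mathcal H}(\xi)=p^\mu\xi\,d^nx_\mu$. The $n$-form $\tilde{j}^1(\phi)^*J^{\mathcal H}(\xi)=N^\mu d^nx_\mu$ on $X$ is the Hamiltonian Noether current, with components $N^\mu=p^\mu\xi$. Covariant Hamiltonian version of Noether's theorem: let ${\mathcal L}$ be regular, let ${\mathcal G}$ act on $Y$ by bundle automorphisms, and let ${\mathcal H}$ be equivariant with respect to ${\mathcal G}$ (that is, ${\mathcal H}(\eta_{P_{\mathcal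 L}}(z))=(\eta_X^{-1})^*{\mathcal H}(z)$ for all $\eta\in{\mathcal G}$, $z\in P_{\mathcal L}$) and not locally constant on any neighborhood in $P_{\mathcal L}$. Then for each $\xi\in{\mathfrak g}$, $d[\tilde{j}^1(\phi)^*J^{\mathcal H}(\xi)]=0$ for any section $\phi$ of $Y$ for which $\tilde{j}^1(\phi)$ is a Hamiltonian system.
   Formalization: The momentum mappings are identified with the Noether current components up to sign and an additive constant (P^μ = −p^μξ + const), and the coordinate formula (0, ξ, −p^μ ∂ξ/∂φ) for the generator of the lifted action is assumed, since it fails for some regular L. *)

(* Defs.v *)
From HB Require Import structures.
From mathcomp Require Import all_boot all_order all_algebra.
From mathcomp Require Import all_classical all_reals all_analysis.
Set Implicit Arguments.
Unset Strict Implicit.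
Unset Printing Implicit Defensive.
Import Order.TTheory GRing.Theory Num.Theory.
Import numFieldNormedType.Exports.
Local Open Scope classical_set_scope.
Local Open Scope ring_scope.

(* Coordinates.
     base  R n = X,      x = (x^1, ..., x^n, x^0): the index ord_max is time
     bundY R n = Y,      (x, phi)
     fiber R n           (phi, phi_mu) or (phi, p^mu), i.e. R^{n+2}
     total R n           (x, (phi, phi_mu)) for J^1(Y), (x, (phi, p^mu)) for
                         the trivial bundle containing P_L
     bundZ R n = Z,      (x, (phi, (p, p^mu)))                              *)
Notation base R n := ('rV[R]_n.+1) (only parsing).
Notation bundY R n := ('rV[R]_n.+1 * R)%type (only parsing).
Notation fiber R n := (R * 'rV[R]_n.+1)%type (only parsing).
Notation total R n := ('rV[R]_n.+1 * (R * 'rV[R]_n.+1))%type (only parsing).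
Notation bundZ R n := ('rV[R]_n.+1 * (R * (R * 'rV[R]_n.+1)))%type
  (only parsing).

Definition evec (R : realType) (n : nat) (mu : 'I_n.+1) : base R n :=
  delta_mx 0 mu.

(* C^k on an open subset U of a finite-dimensional space. *)
Fixpoint Ck_on (R : realType) (V W : normedModType R) (k : nat) (U : set V)
    (f : V -> W) : Prop :=
  match k with
  | 0%N => forall x, U x -> {for x, continuous f}
  | k'.+1 => (forall x, U x -> differentiable f x) /\
             (forall v, Ck_on k' U (fun x => 'D_v f x))
  end.

Definition smooth_on (R : realType) (V W : normedModType R) (U : set V)
    (f : V -> W) : Prop :=
  forall k, Ck_on k U f.

Definition smooth (R : realType) (V W : normedModType R) (f : V -> W) : Prop :=
  smooth_on setT f.

(* Differential k-forms on a vector space V: alpha z v_0 ... v_{k-1}. The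
   type does not record that alpha z is alternating and multilinear. *)
Definition form (R : realType) (V : normedModType R) (k : nat) : Type :=
  V -> ('I_k -> V) -> R.

Definition scons (T : Type) (k : nat) (u : T) (v : 'I_k -> T) : 'I_k.+1 -> T :=
  fun i => if unlift ord0 i is Some j then v j else u.

Definition interior_prod (R : realType) (V : normedModType R) (k : nat)
    (U : V -> V) (alpha : form V k.+1) : form V k :=
  fun z v => alpha z (scons (U z) v).

Definition pullback (R : realType) (V W : normedModType R) (k : nat)
    (f : V -> W) (alpha : form W k) : form V k :=
  fun z v => alpha (f z) (fun i => 'd f z (v i)).

Definition ext_d (R : realType) (V : normedModType R) (k : nat)
    (alpha : form V k) : form V k.+1 :=
  fun z v => \sum_(i < k.+1)
    (-1) ^+ i * 'D_(v i) (fun y => alpha y (fun j => v (lift i j))) z.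

Definition dfun (R : realType) (V : normedModType R) (f : V -> R) : form V 1 :=
  fun z v => 'd f z (v ord0).

Definition wedge1 (R : realType) (V : normedModType R) (k : nat)
    (theta : form V 1) (alpha : form V k) : form V k.+1 :=
  fun z v => \sum_(i < k.+1)
    (-1) ^+ i * theta z (fun=> v i) * alpha z (fun j => v (lift i j)).

(* d^{n+1}x and d^n x_mu *)
Definition vol (R : realType) (n : nat) : form (base R n) n.+1 :=
  fun _ v => \det (\matrix_(i < n.+1, j < n.+1) v i 0 j).

Definition dnx (R : realType) (n : nat) (mu : 'I_n.+1) : form (base R n) n :=
  interior_prod (fun=> evec R mu) (@vol R n).

Definition legendreZ (R : realType) (n : nat) (L : fiber R n -> R)
    (j : total R n) : bundZ R n :=
  let p : base R n := \row_mu 'D_((0 : R), evec R mu) L j.2 in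
  (j.1, (j.2.1, (L j.2 - \sum_mu p 0 mu * j.2.2 0 mu, p))).

(* P_L is parametrized by (x, phi, p^mu): its points are recorded without the
   coordinate p, which on P_L is a function of the other ones. *)
Definition legendre (R : realType) (n : nat) (L : fiber R n -> R)
    (j : total R n) : total R n :=
  let z := legendreZ L j in (z.1, (z.2.1, z.2.2.2)).

Definition PL (R : realType) (n : nat) (L : fiber R n -> R) :
    set (total R n) :=
  range (legendre L).

Definition legendre_inv (R : realType) (n : nat) (L : fiber R n -> R)
    (z : total R n) : total R n :=
  xget 0 [set j | legendre L j = z].

(* The Legendre transformation is a diffeomorphism onto P_L, and
   (x^mu, phi, p^mu) are coordinates on P_L. *)
Definition regular (R : realType) (n : nat) (L : fiber R n -> R) : Prop :=
  [/\ open (PL L), injective (legendre L), smooth (legendre L)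
    & smooth_on (PL L) (legendre_inv L)].

Definition inclZ (R : realType) (n : nat) (L : fiber R n -> R)
    (z : total R n) : bundZ R n :=
  legendreZ L (legendre_inv L z).

Definition Ham (R : realType) (n : nat) (L : fiber R n -> R)
    (z : total R n) : R :=
  let j := legendre_inv L z in
  \sum_mu z.2.2 0 mu * j.2.2 0 mu - L j.2.

Definition ThetaZ (R : realType) (n : nat) : form (bundZ R n) n.+1 :=
  fun z v =>
    \sum_mu z.2.2.2 0 mu *
      wedge1 (dfun (fun w : bundZ R n => w.2.1))
             (pullback (fun w : bundZ R n => w.1) (@dnx R n mu)) z v
    + z.2.2.1 * pullback (fun w : bundZ R n => w.1) (@vol R n) z v.

Definition ThetaH (R : realType) (n : nat) (L : fiber R n -> R) :
    form (total R n) n.+1 :=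
  fun z v =>
    \sum_mu z.2.2 0 mu *
      wedge1 (dfun (fun w : total R n => w.2.1))
             (pullback (fun w : total R n => w.1) (@dnx R n mu)) z v
    - Ham L z * pullback (fun w : total R n => w.1) (@vol R n) z v.

Definition OmegaH (R : realType) (n : nat) (L : fiber R n -> R) :
    form (total R n) n.+2 :=
  fun z v => - ext_d (ThetaH L) z v.

Definition jet1 (R : realType) (n : nat) (phi : base R n -> R)
    (x : base R n) : total R n :=
  (x, (phi x, \row_mu 'D_(evec R mu) phi x)).

Definition jtilde (R : realType) (n : nat) (L : fiber R n -> R)
    (phi : base R n -> R) (x : base R n) : total R n :=
  legendre L (jet1 phi x).

Definition hamiltonian_section (R : realType) (n : nat) (L : fiber R n -> R)
    (phi : base R n -> R) : Prop :=
  forall (U : total R n -> total R n) x v,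
    pullback (jtilde L phi) (interior_prod U (OmegaH L)) x v = 0.

(* The Lie group is presented by its underlying group G, its Lie algebra g and
   the exponential map, through which every generator is defined. eta is the
   action on the fiber R of Y. *)
Definition exponential (R : realType) (G : groupType) (g : lmodType R)
    (exp : g -> G) : Prop :=
  forall (xi : g) (s t : R),
    exp ((s + t) *: xi) = (exp (s *: xi) * exp (t *: xi))%g.

Definition smooth_action (R : realType) (G : groupType) (g : lmodType R)
    (exp : g -> G) (eta : G -> R -> R) : Prop :=
  [/\ forall y, eta 1%g y = y,
      forall a b y, eta (a * b)%g y = eta a (eta b y),
      forall a, smooth (eta a)
    & forall xi : g, smooth (fun q : R * R => eta (exp (q.1 *: xi)) q.2)].

Definition etaY (R : realType) (n : nat) (G : groupType) (eta : G -> R -> R)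
    (a : G) (y : bundY R n) : bundY R n :=
  (y.1, eta a y.2).

(* A jet (x, phi, phi_mu) is the linear map gamma sending evec mu to
   (evec mu, phi_mu). Since eta_X is the identity, eta_J1 (gamma) is
   T eta_Y \o gamma, and its mu-th coordinate is the phi-component of the image
   of evec mu. *)
Definition etaJ1 (R : realType) (n : nat) (G : groupType) (eta : G -> R -> R)
    (a : G) (j : total R n) : total R n :=
  let y : bundY R n := (j.1, j.2.1) in
  let y' := etaY eta a y in
  (y'.1, (y'.2, \row_mu ('d (etaY eta a) y (evec R mu, j.2.2 0 mu)).2)).

Definition etaP (R : realType) (n : nat) (L : fiber R n -> R) (G : groupType)
    (eta : G -> R -> R) (a : G) (z : total R n) : total R n :=
  legendre L (etaJ1 eta a (legendre_inv L z)).

(* The (n+1)-form on Y represented by a point of Z. *)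
Definition formZ (R : realType) (n : nat) (z : bundZ R n) :
    form (bundY R n) n.+1 :=
  fun y v =>
    \sum_mu z.2.2.2 0 mu *
      wedge1 (dfun (fun w : bundY R n => w.2))
             (pullback (fun w : bundY R n => w.1) (@dnx R n mu)) y v
    + z.2.2.1 * pullback (fun w : bundY R n => w.1) (@vol R n) y v.

(* Canonical lift z |-> (eta_Y^-1)^* z. The coordinates p and p^mu of a form
   alpha are its values on (d_1, ..., d_n, d_0) and on the same tuple with d_mu
   replaced by d/dphi. *)
Definition etaZ (R : realType) (n : nat) (G : groupType) (eta : G -> R -> R)
    (a : G) (z : bundZ R n) : bundZ R n :=
  let y' : bundY R n := etaY eta a (z.1, z.2.1) in
  let alpha := pullback (etaY eta a^-1%g) (formZ z) y' in
  (y'.1, (y'.2,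
    (alpha (fun i => (evec R i, 0)),
     \row_mu alpha (fun i => if i == mu then (0, 1) else (evec R i, 0))))).

Definition genY (R : realType) (G : groupType) (g : lmodType R)
    (exp : g -> G) (eta : G -> R -> R) (xi : g) (y : R) : R :=
  'D_1 (fun t : R => eta (exp (t *: xi)) y) 0.

Definition genP (R : realType) (n : nat) (L : fiber R n -> R) (G : groupType)
    (g : lmodType R) (exp : g -> G) (eta : G -> R -> R) (xi : g)
    (z : total R n) : total R n :=
  'D_1 (fun t : R => etaP L eta (exp (t *: xi)) z) 0.

Definition genZ (R : realType) (n : nat) (G : groupType)
    (g : lmodType R) (exp : g -> G) (eta : G -> R -> R) (xi : g)
    (z : bundZ R n) : bundZ R n :=
  'D_1 (fun t : R => etaZ eta (exp (t *: xi)) z) 0.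

(* The coordinate expression (0, xi, - p^mu dxi/dphi) of the generator of etaP.
   It is automatic when L is invariant under etaJ1, but not in general, even if
   the Hamiltonian is invariant: for n = 0, L = phi_0^2/2 + b(phi) phi_0 and
   translations of phi, it is (0, 1, b'(phi)). *)
Definition lifted_generator (R : realType) (n : nat) (L : fiber R n -> R)
    (G : groupType) (g : lmodType R) (exp : g -> G) (eta : G -> R -> R) :
    Prop :=
  forall (xi : g) (z : total R n), PL L z ->
    genP L exp eta xi z =
      (0, (genY exp eta xi z.2.1,
           - 'D_1 (genY exp eta xi) z.2.1 *: z.2.2)).

Definition JH (R : realType) (n : nat) (L : fiber R n -> R) (G : groupType)
    (g : lmodType R) (exp : g -> G) (eta : G -> R -> R) (xi : g) :
    form (total R n) n :=
  pullback (inclZ L) (interior_prod (genZ exp eta xi) (@ThetaZ R n)).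

Definition noether_current (R : realType) (n : nat) (L : fiber R n -> R)
    (G : groupType) (g : lmodType R) (exp : g -> G) (eta : G -> R -> R)
    (xi : g) (phi : base R n -> R) : form (base R n) n :=
  pullback (jtilde L phi) (JH L exp eta xi).

(* The functions N^mu on the fiber of P_L give the components of the Noether
   current of every section. *)
Definition noether_components (R : realType) (n : nat) (L : fiber R n -> R)
    (G : groupType) (g : lmodType R) (exp : g -> G) (eta : G -> R -> R)
    (xi : g) (N : 'I_n.+1 -> fiber R n -> R) : Prop :=
  forall phi : base R n -> R, smooth phi -> forall x v,
    noether_current L exp eta xi phi x v =
      \sum_mu N mu (jtilde L phi x).2 * @dnx R n mu x v.

Definition ham_density (R : realType) (n : nat) (L : fiber R n -> R)
    (z : total R n) : ('I_n.+1 -> base R n) -> R :=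
  fun v => Ham L z * @vol R n z.1 v.

(* eta_X is the identity, hence so is (eta_X^-1)^*. *)
Definition ham_equivariant (R : realType) (n : nat) (L : fiber R n -> R)
    (G : groupType) (eta : G -> R -> R) : Prop :=
  forall (a : G) (z : total R n), PL L z ->
    forall v, ham_density L (etaP L eta a z) v = ham_density L z v.

Definition ham_nowhere_locally_constant (R : realType) (n : nat)
    (L : fiber R n -> R) : Prop :=
  forall z, PL L z ->
    ~ (\forall w \near z, PL L w -> Ham L w = Ham L z).

Definition omega (R : realType) (n : nat) (mu : 'I_n.+1) :
    form (fiber R n) 2 :=
  wedge1 (dfun (fun f : fiber R n => f.2 0 mu))
         (dfun (fun f : fiber R n => f.1)).

(* xi_P contracted with omega^(mu) equals dP^mu(xi), the differential being taken
   along the fiber of P_L. The interior product fills the first slot, so that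
   omega^(mu) = dp^mu /\ dphi and xi_P = (0, xi, - p^mu dxi/dphi) give
   dP^mu(xi) = - d(p^mu xi): P^mu(xi) is the opposite of p^mu xi, up to an
   additive constant. *)
Definition momentum_mapping (R : realType) (n : nat) (L : fiber R n -> R)
    (G : groupType) (g : lmodType R) (exp : g -> G) (eta : G -> R -> R)
    (P : 'I_n.+1 -> g -> fiber R n -> R) : Prop :=
  forall mu (xi : g) (x : base R n) (f : fiber R n), PL L (x, f) ->
    differentiable (P mu xi) f /\
    forall v, interior_prod (fun f' => (genP L exp eta xi (x, f')).2)
                            (@omega R n mu) f v
              = dfun (P mu xi) f v.

Definition bridges_invariant (R : realType) (n : nat) (L : fiber R n -> R)
    (G : groupType) (g : lmodType R) (exp : g -> G) (eta : G -> R -> R) :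
    Prop :=
  forall (xi : g) (z : total R n), PL L z ->
    'd (Ham L) z (genP L exp eta xi z) = 0.

Definition momentum_divergence (R : realType) (n : nat) (L : fiber R n -> R)
    (g : lmodType R) (P : 'I_n.+1 -> g -> fiber R n -> R) (xi : g)
    (phi : base R n -> R) (x : base R n) : R :=
  \sum_mu 'D_(evec R mu) (fun y => P mu xi (jtilde L phi y).2) x.

(* Main.v *)
(* On a vertical generator the canonical form reduces to p^mu xi d^n x_mu, so
   the Noether current has components N^mu = p^mu xi, and the coordinate
   expression (0, xi, - p^mu dxi/dphi) of the generator makes its contraction
   with omega^(mu) equal to - dN^mu. Hence P^mu + N^mu has zero differential on
   the fiber of P_L; that fiber is the image of R^{n+2} under the Legendre map,
   so P^mu + N^mu pulls back to a function with zero differential on a vector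
   space and is constant. Conversely every point of P_L lies on the jet of an
   affine section, so the components of the current determine P^mu up to
   constants.
   For the conservation law, evaluating the Hamiltonian system on the generator
   gives div N = - dH(xi_P), and dH(xi_P) is the derivative of the Hamiltonian
   along the orbit of the flow. *)
From HB Require Import structures.
From mathcomp Require Import all_boot all_order all_algebra.
From mathcomp Require Import all_classical all_reals all_analysis.
From mathcomp Require Import ring.
Require Import Defs.
Import Order.TTheory GRing.Theory Num.Theory.
Import numFieldNormedType.Exports.
Local Open Scope classical_set_scope.
Local Open Scope ring_scope.

(** * Volume form and its contractions *)

Lemma scons_ord0 (T : Type) (k : nat) (u : T) (v : 'I_k -> T) :
  scons u v ord0 = u.
Proof. by rewrite /scons unlift_none. Qed.

Lemma scons_lift0 (T : Type) (k : nat) (u : T) (v : 'I_k -> T) (i : 'I_k) :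
  scons u v (lift ord0 i) = v i.
Proof. by rewrite /scons liftK. Qed.

Lemma scons_skip0 (T : Type) (k : nat) (u : T) (v : 'I_k -> T) :
  (fun j => scons u v (lift ord0 j)) = v.
Proof. by apply/funext => j; rewrite scons_lift0. Qed.

(** Deleting a later entry keeps [u] in front; the terms of [ext_d] beyond the first have this shape
    when [u] fills the first slot. *)
Lemma scons_skip (T : Type) (k : nat) (u : T) (v : 'I_k.+1 -> T)
    (i : 'I_k.+1) :
  (fun j => scons u v (lift (lift ord0 i) j)) =
  scons u (fun j => v (lift i j)).
Proof.
apply/funext => j; case: (unliftP ord0 j) => [j'|] ->.
  suff -> : lift (lift ord0 i) (lift ord0 j') = lift ord0 (lift i j')
    by rewrite !scons_lift0.
  by apply: val_inj; rewrite /= /bump /= !add1n ltnS addnS.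
suff -> : lift (lift ord0 i) ord0 = ord0 by rewrite !scons_ord0.
exact: val_inj.
Qed.

Lemma evecE (R : realType) (n : nat) (mu j : 'I_n.+1) :
  evec R mu 0 j = (mu == j)%:R.
Proof. by rewrite /evec mxE eqxx /= eq_sym. Qed.

Lemma vol_eq0 (R : realType) (n : nat) (x : base R n) v (i : 'I_n.+1) :
  v i = 0 -> @vol R n x v = 0.
Proof.
move=> vi0; rewrite /vol (expand_det_row _ i) big1 // => j _.
by rewrite mxE vi0 mxE mul0r.
Qed.

Lemma vol_evec (R : realType) (n : nat) (x : base R n) :
  @vol R n x (@evec R n) = 1.
Proof.
rewrite /vol -[RHS](det1 R n.+1); congr (\det _).
by apply/matrixP => i j; rewrite !mxE eqxx /= eq_sym.
Qed.

(** The first row of the determinant in [dnx] is [evec R mu], so expansion along it leaves one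
    minor, that of [w] without row [i] and column [mu]; the signs combine to that of the
    cofactor. *)
Lemma dnx_cofactor (R : realType) (n : nat) (mu : 'I_n.+1) (x : base R n)
    (v : 'I_n -> base R n) (w : 'I_n.+1 -> base R n) (i : 'I_n.+1) :
  (forall j, v j = w (lift i j)) ->
  (-1) ^+ i * dnx mu x v = cofactor (\matrix_(a, b) w a 0 b) i mu.
Proof.
move=> vw; rewrite /dnx /interior_prod /vol (expand_det_row _ ord0).
rewrite (bigD1 mu) //=.
rewrite big1 ?addr0 => [|j jmu]; last first.
  by rewrite mxE scons_ord0 evecE eq_sym (negPf jmu) mul0r.
rewrite mxE scons_ord0 evecE eqxx mul1r /cofactor add0n mulrA -exprD.
congr (_ * \det _); apply/matrixP => a b.
by rewrite !mxE scons_lift0 vw.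
Qed.

(** This is l /\ d^n x_mu = l(e_mu) d^{n+1}x. Expanding [l] in coordinates produces entries of the
    adjugate times the matrix of [w], a scalar matrix. *)
Lemma wedge1_dnx (R : realType) (n : nat) (mu : 'I_n.+1) (x : base R n)
    (l : {linear base R n -> R}) (w : 'I_n.+1 -> base R n) :
  \sum_(i < n.+1) (-1) ^+ i * l (w i) * dnx mu x (fun j => w (lift i j)) =
  l (evec R mu) * vol x w.
Proof.
pose M : 'M[R]_n.+1 := \matrix_(a, b) w a 0 b.
have lE u : l u = \sum_nu u 0 nu * l (evec R nu).
  rewrite {1}[u]row_sum_delta linear_sum.
  by apply: eq_bigr => nu _; rewrite linearZ.
under eq_bigr => i _.
  rewrite mulrAC (@dnx_cofactor _ _ _ _ _ w) // lE mulr_sumr; over.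
rewrite exchange_big /=.
transitivity (\sum_nu l (evec R nu) * (\adj M *m M) mu nu).
  apply: eq_bigr => nu _; rewrite mxE mulr_sumr; apply: eq_bigr => i _.
  by rewrite !mxE mulrA mulrC.
rewrite mul_adj_mx (bigD1 mu) //= big1 ?addr0 => [|nu numu].
  by rewrite !mxE eqxx.
by rewrite !mxE eq_sym (negPf numu) mulr0.
Qed.

Lemma dnx_eq0 (R : realType) (n : nat) (mu : 'I_n.+1) (x : base R n)
    (v : 'I_n -> base R n) (i : 'I_n) :
  v i = 0 -> dnx mu x v = 0.
Proof.
by move=> vi0; apply: (@vol_eq0 _ _ _ _ (lift ord0 i)); rewrite scons_lift0.
Qed.

(* dphi /\ d^n x_mu on vectors with phi- and x-components a_i and w_i, the
   first of them vertical. *)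
Lemma wedge1_dnx_vertical (R : realType) (n : nat) (mu : 'I_n.+1)
    (x : base R n) (a : 'I_n.+1 -> R) (w : 'I_n.+1 -> base R n) :
  w ord0 = 0 ->
  \sum_(i < n.+1) (-1) ^+ i * a i * dnx mu x (fun j => w (lift i j)) =
  a ord0 * dnx mu x (fun j => w (lift ord0 j)).
Proof.
move=> w0; rewrite big_ord_recl /= expr0 mul1r big1 ?addr0 // => i _.
(* For n = 0 no term is left; otherwise [w ord0] is still the first argument of [dnx] after a later
   entry is deleted, and it is 0. *)
case: n mu x a w w0 i => [|n] mu x a w w0 i; first by case: i.
rewrite (@dnx_eq0 _ _ _ _ _ ord0) ?mulr0 // -[RHS]w0.
by congr w; exact: val_inj.
Qed.

(** On the coordinate frame with [evec R mu] deleted, every [dnx nu] with [nu] other than [mu]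
    vanishes and [dnx mu] is a sign, which isolates each coefficient. *)
Lemma dnx_free (R : realType) (n : nat) (x : base R n) (N : 'I_n.+1 -> R) :
  (forall v, \sum_mu N mu * dnx mu x v = 0) -> forall mu, N mu = 0.
Proof.
move=> N0 mu.
have key nu : (-1) ^+ mu * dnx nu x (fun j => evec R (lift mu j)) =
    (mu == nu)%:R.
  rewrite (@dnx_cofactor _ _ _ _ _ (@evec R n)) //.
  have -> : \matrix_(a, b) evec R a 0 b = 1%:M :> 'M[R]_n.+1.
    by apply/matrixP => a b; rewrite !mxE eqxx eq_sym.
  have /matrixP/(_ nu mu) := mul_adj_mx (1%:M : 'M[R]_n.+1).
  by rewrite mulmx1 det1 !mxE eq_sym.
have := N0 (fun j => evec R (lift mu j)).
move=> /(congr1 (fun r => (-1) ^+ mu * r)); rewrite mulr0 mulr_sumr => <-.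
rewrite (bigD1 mu) //= mulrCA key eqxx mulr1 big1 ?addr0 // => nu numu.
by rewrite mulrCA key eq_sym (negPf numu) mulr0.
Qed.

(** * Differentials *)

Section Calculus.
Context {R : realType}.
Implicit Types V W : normedModType R.

Lemma is_diff_fst V W (z : V * W) : is_diff z (@fst V W) (@fst V W).
Proof.
have c : continuous (@fst V W) by move=> ?; exact: cvg_fst.
by apply: DiffDef; [exact: linear_differentiable | exact: diff_lin].
Qed.

Lemma is_diff_snd V W (z : V * W) : is_diff z (@snd V W) (@snd V W).
Proof.
have c : continuous (@snd V W) by move=> ?; exact: cvg_snd.
by apply: DiffDef; [exact: linear_differentiable | exact: diff_lin].
Qed.

Lemma diffable_fst V W (z : V * W) : differentiable (@fst V W) z.
Proof. by have [] := is_diff_fst _ _ z. Qed.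

Lemma diffable_snd V W (z : V * W) : differentiable (@snd V W) z.
Proof. by have [] := is_diff_snd _ _ z. Qed.

Lemma diff_fst V W (z : V * W) : 'd (@fst V W) z = @fst V W :> (_ -> _).
Proof. by have [] := is_diff_fst _ _ z. Qed.

Lemma diff_snd V W (z : V * W) : 'd (@snd V W) z = @snd V W :> (_ -> _).
Proof. by have [] := is_diff_snd _ _ z. Qed.

Lemma is_diff_coord n (i : 'I_n) (u : 'rV[R]_n) :
  is_diff u (fun v : 'rV[R]_n => v 0 i) (fun v : 'rV[R]_n => v 0 i).
Proof.
have @f : {linear 'rV[R]_n -> R}.
  by exists (fun v : 'rV[R]_n => v 0 i); do 2![eexists]; do ?[constructor];
     rewrite ?mxE// => ? *; rewrite ?mxE//; move=> ?; rewrite !mxE.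
have c : continuous f by exact: coord_continuous.
apply: DiffDef; first exact: (linear_differentiable _ c).
exact: (diff_lin _ c).
Qed.

Lemma is_diff_row V n (F dF : 'I_n -> V -> R) (x : V) :
  (forall i, is_diff x (F i) (dF i)) ->
  is_diff x (fun y => \row_i F i y) (fun v => \row_i dF i v).
Proof.
move=> FdF.
have rowE (H : 'I_n -> V -> R) : (fun y => \row_i H i y) =
    \sum_i (fun y => H i y *: (delta_mx 0 i : 'rV[R]_n)).
  apply/funext => y; rewrite fct_sumE [LHS]row_sum_delta.
  by apply: eq_bigr => i _; rewrite mxE.
rewrite !rowE; elim/big_ind2 : _ => [||i _].
- exact: is_diff_cst.
- by move=> f df h dh; exact: is_diffD.
- have [dFi dFiE] := FdF i.
  by apply: DiffDef; [exact: differentiableZl | rewrite diffZl // dFiE].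
Qed.

(** Serves for maps whose formula is known only on the open set [PL L]: the first-order expansion of
    [f] is also one for [h], and differentials are unique. *)
Lemma near_eq_is_diff V W (f h df : V -> W) (x : V) :
  (\near x, f x = h x) -> is_diff x f df -> is_diff x h df.
Proof.
move=> fh [fx fdf].
have fhx : f x = h x by exact: nbhs_singleton fh.
have hE : h \o shift x = cst (h x) + 'd f x +o_ 0 id.
  have /diff_locally/eqaddoP fo := fx.
  apply/eqaddoP => e e0; have := fo e e0.
  have : \forall y \near (0 : V), f (y + x) = h (y + x).
    by have := near_shift 0 x (fun y => f y = h y); rewrite subr0 => <-.
  by apply: filterS2 => y; rewrite /= !fctE /= fhx => ->.
have hf : 'd h x = 'd f x :> (V -> W).
  by apply: diff_unique hE; exact: diff_continuous.
apply: DiffDef; last by rewrite hf.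
by apply/diff_locallyP; rewrite hf; split => //; exact: diff_continuous.
Qed.

Lemma diff_fst_near V W W' (f : V -> W * W') (h dh : V -> W) (x : V) :
  differentiable f x -> (\near x, h x = (f x).1) -> is_diff x h dh ->
  forall v, ('d f x v).1 = dh v.
Proof.
move=> fx hf hdh v; have [_ <-] := near_eq_is_diff _ _ _ _ _ _ hf hdh.
have fstE : (fun y => (f y).1) = fst \o f by [].
rewrite fstE (@diff_comp _ _ _ _ f fst) ?diff_fst //.
exact: diffable_fst.
Qed.

Lemma is_diff_derive V W (f df : V -> W) (x v : V) :
  is_diff x f df -> 'D_v f x = df v.
Proof. by move=> [fx <-]; rewrite deriveE. Qed.

(** Restriction to the segment from [x] to [y] reduces this to a function of one real variable. *)
Lemma diff0_const V (f : V -> R) :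
  (forall x, is_diff x f (fun=> 0)) -> forall x y, f x = f y.
Proof.
move=> f0 x y; pose c := fun t : R => x + t *: (y - x).
have dc t : differentiable c t.
  apply: differentiableD; first exact: differentiable_cst.
  by apply: differentiableZl.
have -> : f x = (f \o c) 0 by rewrite /c /= scale0r addr0.
have -> : f y = (f \o c) 1 by rewrite /c /= scale1r addrC subrK.
apply: is_derive_0_is_cst => t; have [fct ft0] := f0 (c t).
have dfc : differentiable (f \o c) t by exact: differentiable_comp.
apply: DeriveDef; first exact: diff_derivable.
by rewrite deriveE // diff_comp //= ft0.
Qed.

Lemma derive_curve V W (c : R -> V) (f : V -> W) (t : R) :
  differentiable c t -> differentiable f (c t) ->
  'D_1 (f \o c) t = 'd f (c t) ('D_1 c t).
Proof.
move=> dc df; rewrite !deriveE //; first by rewrite diff_comp.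
exact: differentiable_comp.
Qed.

Lemma smooth_diff V W (f : V -> W) : smooth f -> forall x, differentiable f x.
Proof. by move=> /(_ 1%N)[/(_ _ I)]. Qed.

Lemma smooth_diff_derive V W (f : V -> W) (v : V) :
  smooth f -> forall x, differentiable (fun y => 'D_v f y) x.
Proof. by move=> /(_ 2%N)[_ /(_ v)[+ _]] x; exact. Qed.

End Calculus.

(** * Legendre transformation *)

Section Legendre.
Context {R : realType} {n : nat} (L : fiber R n -> R).
Hypotheses (L_smooth : smooth L) (L_reg : regular L).

Lemma PL_legendre j : PL L (legendre L j).
Proof. by exists j. Qed.

Lemma legendre_invK z : PL L z -> legendre L (legendre_inv L z) = z.
Proof.
move=> [j _ jz]; apply: (xgetPex 0 (P := [set j | legendre L j = z])).
by exists j.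
Qed.

Lemma legendreK j : legendre_inv L (legendre L j) = j.
Proof.
case: L_reg => _ inj _ _; apply: inj; rewrite legendre_invK //.
exact: PL_legendre.
Qed.

Lemma PL_near z : PL L z -> \near z, PL L z.
Proof. by case: L_reg => PLo _ _ _ PLz; exact: open_nbhs_nbhs. Qed.

Lemma legendre_inv_base z : PL L z -> (legendre_inv L z).1 = z.1.
Proof. by move=> /legendre_invK zE; rewrite -[in RHS]zE. Qed.

Lemma legendre_diff j : differentiable (legendre L) j.
Proof. by case: L_reg => _ _ leg_smooth _; exact: smooth_diff. Qed.

Lemma legendre_inv_diff z : PL L z -> differentiable (legendre_inv L) z.
Proof. by case: L_reg => _ _ _ /(_ 1%N)[+ _]; exact. Qed.

Lemma velocity_diff mu z : PL L z ->
  differentiable (fun w => (legendre_inv L w).2.2 0 mu) z.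
Proof.
move=> PLz.
apply: (differentiable_comp (g := fun u : base R n => u 0 mu)); last first.
  exact: differentiable_coord.
apply: (differentiable_comp (g := snd)); last exact: diffable_snd.
apply: (differentiable_comp (g := snd)); last exact: diffable_snd.
exact: legendre_inv_diff.
Qed.

Lemma momentum_diff mu (z : total R n) :
  differentiable (fun w : total R n => w.2.2 0 mu) z.
Proof.
apply: (differentiable_comp (g := fun u : base R n => u 0 mu)); last first.
  exact: differentiable_coord.
apply: (differentiable_comp (g := snd)); last exact: diffable_snd.
exact: diffable_snd.
Qed.

Lemma Ham_diff z : PL L z -> differentiable (Ham L) z.
Proof.
move=> PLz; have invd := legendre_inv_diff _ PLz.
have -> : Ham L = \sum_mu ((fun w : total R n => w.2.2 0 mu) *
    (fun w => (legendre_inv L w).2.2 0 mu)) - (L \o snd \o legendre_inv L).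
  by apply/funext => w; rewrite /Ham /= !fctE fct_sumE.
apply: differentiableB.
  apply: differentiable_sum => mu; apply: differentiableM.
    exact: momentum_diff.
  exact: velocity_diff.
apply: differentiable_comp => //; apply: differentiable_comp.
  exact: diffable_snd.
exact: smooth_diff.
Qed.

(** On P_L the omitted coordinate p = L - p^mu phi_mu is the opposite of the Hamiltonian. *)
Lemma inclZE z :
  PL L z -> inclZ L z = (z.1, (z.2.1, (- Ham L z, z.2.2))).
Proof. by move=> [j _ <-]; rewrite /inclZ /Ham legendreK opprB. Qed.

Lemma inclZ_diff z : PL L z -> differentiable (inclZ L) z.
Proof.
move=> PLz; have invd := legendre_inv_diff _ PLz.
have zE : \near z, (z.1, (z.2.1, (- Ham L z, z.2.2))) = inclZ L z.
  by near=> w; rewrite inclZE //; near: w; exact: PL_near.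
suff /differentiableP/(near_eq_is_diff _ _ _ _ _ _ zE)[//] : differentiable
    (fun w : total R n => (w.1, (w.2.1, (- Ham L w, w.2.2)))) z.
apply: differentiable_pair; first exact: diffable_fst.
have snd_d := diffable_snd _ _ z.
apply: differentiable_pair.
  by apply: (differentiable_comp (g := fst)) => //; exact: diffable_fst.
apply: differentiable_pair.
  by apply: differentiableN; exact: Ham_diff.
by apply: (differentiable_comp (g := snd)) => //; exact: diffable_snd.
Unshelve. all: by end_near. Qed.

Lemma diff_inclZ_base z v : PL L z -> ('d (inclZ L) z v).1 = v.1.
Proof.
move=> PLz; apply: (diff_fst_near _ _ _ _ fst) => //.
- exact: inclZ_diff.
- by near=> w; rewrite [RHS]legendre_inv_base //; near: w; exact: PL_near.
- exact: is_diff_fst.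
Unshelve. all: by end_near. Qed.

Lemma jet1_diff (phi : base R n -> R) x : smooth phi ->
  differentiable (jet1 phi) x.
Proof.
move=> phi_smooth; apply: differentiable_pair => //.
apply: differentiable_pair; first exact: smooth_diff.
have [] // := is_diff_row _ _ (fun mu y => 'D_(evec R mu) phi y)
  (fun mu => 'd (fun y => 'D_(evec R mu) phi y) x) x.
by move=> mu; apply: differentiableP; exact: smooth_diff_derive.
Qed.

Lemma jtilde_diff (phi : base R n -> R) x : smooth phi ->
  differentiable (jtilde L phi) x.
Proof.
move=> phi_smooth; apply: differentiable_comp; first exact: jet1_diff.
exact: legendre_diff.
Qed.

Lemma diff_jtilde_base (phi : base R n -> R) x v : smooth phi ->
  ('d (jtilde L phi) x v).1 = v.
Proof.
move=> phi_smooth; apply: (diff_fst_near _ _ _ _ id) => //.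
- exact: jtilde_diff.
- by near=> y.
Unshelve. all: by end_near. Qed.

Lemma diff_jtilde_field (phi : base R n -> R) x v :
  smooth phi -> ('d (jtilde L phi) x v).2.1 = 'd phi x v.
Proof.
move=> phi_smooth; have jd := jtilde_diff _ x phi_smooth.
have <- : 'd (snd \o jtilde L phi) x v = ('d (jtilde L phi) x v).2.
  rewrite (@diff_comp _ _ _ _ _ snd) //; last exact: diffable_snd.
  by rewrite diff_snd.
apply: (diff_fst_near _ _ _ _ phi).
- by apply: differentiable_comp => //; exact: diffable_snd.
- by near=> y.
- by apply: differentiableP; exact: smooth_diff.
Unshelve. all: by end_near. Qed.

End Legendre.

(** * Lifted actions *)

Lemma dfun_fst (R : realType) (W : normedModType R) (z : R * W) v :
  dfun (fun w : R * W => w.1) z v = (v ord0).1.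
Proof. exact: (congr1 (@^~ (v ord0)) (diff_fst _ _ z)). Qed.

Lemma dfun_snd (R : realType) (V : normedModType R) (z : V * R) v :
  dfun (fun w : V * R => w.2) z v = (v ord0).2.
Proof. exact: (congr1 (@^~ (v ord0)) (diff_snd _ _ z)). Qed.

Lemma dfun_snd_fst (R : realType) (V W : normedModType R) (z : V * (R * W)) v :
  dfun (fun w : V * (R * W) => w.2.1) z v = (v ord0).2.1.
Proof.
have [_ dE] := is_diff_comp (is_diff_snd _ _ z) (is_diff_fst _ _ z.2).
exact: (congr1 (@^~ (v ord0)) dE).
Qed.

Lemma dfun_snd_coord (R : realType) (V : normedModType R) (n : nat) (mu : 'I_n)
    (z : V * 'rV[R]_n) v :
  dfun (fun w : V * 'rV[R]_n => w.2 0 mu) z v = (v ord0).2 0 mu.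
Proof.
have [_ dE] := is_diff_comp (is_diff_snd _ _ z) (is_diff_coord _ mu z.2).
exact: (congr1 (@^~ (v ord0)) dE).
Qed.

Lemma pullback_fst (R : realType) (V W : normedModType R) (k : nat)
    (alpha : form V k) (z : V * W) v :
  pullback (fun w : V * W => w.1) alpha z v = alpha z.1 (fun i => (v i).1).
Proof.
rewrite /pullback; congr (alpha _ _); apply/funext => i.
exact: (congr1 (@^~ (v i)) (diff_fst _ _ z)).
Qed.

Lemma formZE (R : realType) (n : nat) (z : bundZ R n) (y : bundY R n) v :
  formZ z y v =
  \sum_mu z.2.2.2 0 mu *
    (\sum_(i < n.+1) (-1) ^+ i * (v i).2 * dnx mu 0 (fun j => (v (lift i j)).1))
  + z.2.2.1 * @vol R n 0 (fun i => (v i).1).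
Proof.
rewrite /formZ pullback_fst; congr (_ + _); apply: eq_bigr => mu _.
congr (_ * _); apply: eq_bigr => i _.
by rewrite pullback_fst dfun_snd.
Qed.

Section Action.
Context {R : realType} {G : groupType} {g : lmodType R}.
Context (exp : g -> G) (eta : G -> R -> R).
Hypotheses (exp_hom : exponential exp) (eta_act : smooth_action exp eta).

Lemma exp_scale0 (xi : g) : exp ((0 : R) *: xi) = 1%g.
Proof.
apply: (@mulgI _ (exp ((0 : R) *: xi))).
by rewrite mulg1 -exp_hom addr0.
Qed.

Lemma exp_scaleN (xi : g) (t : R) : (exp (t *: xi))^-1%g = exp (- t *: xi).
Proof.
apply: (@mulgI _ (exp (t *: xi))).
by rewrite mulgV -exp_hom subrr exp_scale0.
Qed.

Lemma eta_diff a y : differentiable (eta a) y.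
Proof. by case: eta_act => _ _ eta_smooth _; exact: smooth_diff. Qed.

Lemma diff_eta a y r : 'd (eta a) y r = 'D_1 (eta a) y * r.
Proof.
have ed := eta_diff a y; rewrite deriveE // mulrC.
by rewrite -[in LHS](mulr1 r) -[r * 1]/(r *: (1 : R)) linearZ.
Qed.

(** A joint map in time and field value: [genY] and the derivative of [eta (exp (t *: xi))] are its
    two partial derivatives, so both inherit differentiability from its smoothness. *)
Definition flow (xi : g) (q : R * R) : R := eta (exp (q.1 *: xi)) q.2.

Lemma flow_smooth xi : smooth (flow xi).
Proof. by case: eta_act => _ _ _ /(_ xi). Qed.

Lemma derive_eta (xi : g) (t y : R) :
  'D_1 (eta (exp (t *: xi))) y = 'D_((0 : R), (1 : R)) (flow xi) (t, y).
Proof.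
have [cd cE] := is_diff_pair (is_diff_cst t y) (is_diff_id y).
have fd := smooth_diff _ _ _ (flow_smooth xi) (t, y).
rewrite -[eta _]/(flow xi \o (fun y => (t, y))) derive_curve //.
by rewrite !deriveE // cE.
Qed.

Lemma genYE (xi : g) (y : R) :
  genY exp eta xi y = 'D_((1 : R), (0 : R)) (flow xi) (0, y).
Proof.
have [cd cE] := is_diff_pair (is_diff_id (0 : R)) (is_diff_cst y (0 : R)).
have fd := smooth_diff _ _ _ (flow_smooth xi) (0, y).
rewrite /genY -[fun t => _]/(flow xi \o (fun t : R => (t, y))) derive_curve //.
by rewrite !deriveE // cE.
Qed.

Lemma genY_diff (xi : g) (y : R) : differentiable (genY exp eta xi) y.
Proof.
have -> : genY exp eta xi =
    (fun q => 'D_((1 : R), (0 : R)) (flow xi) q) \o (fun y => (0, y)).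
  by apply/funext => z; rewrite genYE.
apply: differentiable_comp; first exact: differentiable_pair.
exact: smooth_diff_derive _ _ _ _ (flow_smooth xi) _.
Qed.

Lemma flow_curve_diff (xi : g) (y : R) (t : R) :
  differentiable (fun t : R => eta (exp (t *: xi)) y) t.
Proof.
rewrite -[fun t => _]/(flow xi \o (fun t : R => (t, y))).
apply: differentiable_comp; first exact: differentiable_pair.
exact: smooth_diff (flow_smooth xi) _.
Qed.

Lemma is_diff_etaY n a (y : bundY R n) :
  is_diff y (etaY eta a) (fun v => (v.1, 'D_1 (eta a) y.2 * v.2)).
Proof.
have -> : (fun v : bundY R n => (v.1, 'D_1 (eta a) y.2 * v.2)) =
    (fun v => (v.1, 'd (eta a) (y.2) v.2)).
  by apply/funext => v; rewrite /= diff_eta.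
have yd := is_diff_snd _ _ y; have ad := differentiableP (eta_diff a y.2).
exact: is_diff_pair (is_diff_fst _ _ y) (is_diff_comp yd ad).
Qed.

Lemma etaJ1E n a (j : total R n) :
  etaJ1 eta a j = (j.1, (eta a j.2.1, 'D_1 (eta a) j.2.1 *: j.2.2)).
Proof.
rewrite /etaJ1 /=; congr (_, (_, _)); apply/rowP => mu.
by have [_ ->] := is_diff_etaY n a (j.1, j.2.1); rewrite !mxE.
Qed.

Lemma etaJ1M n a b (j : total R n) :
  etaJ1 eta (a * b)%g j = etaJ1 eta a (etaJ1 eta b j).
Proof.
have [_ etaM _ _] := eta_act; have bd := eta_diff b j.2.1.
have ad := eta_diff a (eta b j.2.1).
rewrite !etaJ1E /= etaM scalerA; congr (_, (_, _ *: _)).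
have -> : eta (a * b)%g = eta a \o eta b by apply/funext => y; rewrite etaM.
by rewrite derive_curve // diff_eta.
Qed.

Lemma etaJ1_1 n (j : total R n) : etaJ1 eta 1%g j = j.
Proof.
have [eta1 _ _ _] := eta_act.
have etaid : eta 1%g = id by apply/funext => y; rewrite eta1.
by rewrite etaJ1E etaid derive_id scale1r; case: j => x [].
Qed.

Lemma etaJ1_curve_diff n (xi : g) (j : total R n) (t : R) :
  differentiable (fun t : R => etaJ1 eta (exp (t *: xi)) j) t.
Proof.
rewrite (_ : (fun t => _) = fun t : R => (j.1, (eta (exp (t *: xi)) j.2.1,
    'D_1 (eta (exp (t *: xi))) j.2.1 *: j.2.2))); last first.
  by apply/funext => s; rewrite etaJ1E.
apply: differentiable_pair => //; apply: differentiable_pair.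
  exact: flow_curve_diff.
apply: differentiableZl.
rewrite (_ : (fun t => _) = (fun q => 'D_((0 : R), (1 : R)) (flow xi) q) \o
    (fun t => (t, j.2.1))); last by apply/funext => s; rewrite derive_eta.
apply: differentiable_comp; first exact: differentiable_pair.
exact: smooth_diff_derive _ _ _ _ (flow_smooth xi) _.
Qed.

(** [etaY] covers the identity and multiplies dphi by the derivative of [eta a]: the terms in dphi
    /\ d^n x_mu acquire this factor, and the volume term is unchanged. *)
Lemma pullback_formZ n a (z : bundZ R n) (y : bundY R n) v :
  pullback (etaY eta a) (formZ z) y v =
  'D_1 (eta a) y.2 * (\sum_mu z.2.2.2 0 mu *
    (\sum_(i < n.+1)
      (-1) ^+ i * (v i).2 * dnx mu 0 (fun j => (v (lift i j)).1)))
  + z.2.2.1 * @vol R n 0 (fun i => (v i).1).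
Proof.
have -> : pullback (etaY eta a) (formZ z) y v = formZ z (etaY eta a y)
    (fun i => ((v i).1, 'D_1 (eta a) y.2 * (v i).2)).
  rewrite /pullback; congr (formZ _ _ _); apply/funext => i.
  by have [_ ->] := is_diff_etaY n a y.
rewrite formZE /=; congr (_ + _).
rewrite mulr_sumr; apply: eq_bigr => mu _; rewrite mulrCA; congr (_ * _).
rewrite mulr_sumr; apply: eq_bigr => i _.
by rewrite mulrCA -!mulrA.
Qed.

Lemma etaZ_curve_diff n (xi : g) (z : bundZ R n) :
  differentiable (fun t : R => etaZ eta (exp (t *: xi)) z) 0.
Proof.
have [_ etaM _ _] := eta_act.
(* The factor in the pulled-back form is the derivative of the inverse at the transported point,
   that is, the field derivative of [flow xi] at (-t, eta (exp (t *: xi)) z.2.1). *)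
have coef_diff : differentiable (fun t : R =>
    'D_1 (eta (exp (t *: xi))^-1%g) (eta (exp (t *: xi)) z.2.1)) 0.
  rewrite (_ : (fun t => _) = (fun q => 'D_((0 : R), (1 : R)) (flow xi) q) \o
      (fun t => (- t, eta (exp (t *: xi)) z.2.1))); last first.
    by apply/funext => t; rewrite /= exp_scaleN derive_eta.
  apply: differentiable_comp.
    apply: differentiable_pair; last exact: flow_curve_diff.
    exact: differentiableN.
  exact: smooth_diff_derive _ _ _ _ (flow_smooth xi) _.
have comp_diff (a b : R) : differentiable (fun t : R =>
    'D_1 (eta (exp (t *: xi))^-1%g) (eta (exp (t *: xi)) z.2.1) * a + b) 0.
  apply: differentiableD; last exact: differentiable_cst.
  by apply: differentiableM.
(* By [pullback_formZ] each form coordinate of [etaZ] is affine in that factor, with slope [A] and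
   constant term [B], taken on the frame [e] for p and [e' mu] for p^mu. *)
pose A (v : 'I_n.+1 -> bundY R n) := \sum_mu z.2.2.2 0 mu *
  (\sum_(i < n.+1) (-1) ^+ i * (v i).2 * dnx mu 0 (fun j => (v (lift i j)).1)).
pose B (v : 'I_n.+1 -> bundY R n) := z.2.2.1 * @vol R n 0 (fun i => (v i).1).
pose e : 'I_n.+1 -> bundY R n := fun i => (evec R i, 0).
pose e' mu : 'I_n.+1 -> bundY R n :=
  fun i => if i == mu then (0, 1) else (evec R i, 0).
have -> : (fun t : R => etaZ eta (exp (t *: xi)) z) =
    (fun t : R => (z.1, (eta (exp (t *: xi)) z.2.1,
      ('D_1 (eta (exp (t *: xi))^-1%g) (eta (exp (t *: xi)) z.2.1) * A e + B e,
      \row_mu ('D_1 (eta (exp (t *: xi))^-1%g) (eta (exp (t *: xi)) z.2.1)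
        * A (e' mu) + B (e' mu)))))).
  apply/funext => t; rewrite /etaZ; congr (_, (_, (_, _))).
    exact: pullback_formZ.
  by apply/rowP => mu; rewrite !mxE; exact: pullback_formZ.
apply: differentiable_pair; first exact: differentiable_cst.
apply: differentiable_pair; first exact: flow_curve_diff.
apply: differentiable_pair; first exact: comp_diff.
have [] // := is_diff_row _ _ (fun mu (t : R) =>
  'D_1 (eta (exp (t *: xi))^-1%g) (eta (exp (t *: xi)) z.2.1) * A (e' mu)
  + B (e' mu)) _ 0 (fun mu => differentiableP (comp_diff _ _)).
Qed.

End Action.

(** * Noether current and momentum mappings *)

(** A vertical first argument kills the volume term, and in dphi /\ d^n x_mu only the term where it
    fills dphi survives. *)
Lemma ThetaZ_vertical (R : realType) (n : nat) (z u : bundZ R n) v :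
  u.1 = 0 ->
  ThetaZ z (scons u v) =
  \sum_mu z.2.2.2 0 mu * (u.2.1 * dnx mu 0 (fun j => (v j).1)).
Proof.
move=> u0.
rewrite /ThetaZ pullback_fst [X in _ + _ * X](@vol_eq0 _ _ _ _ ord0);
  last first.
  by rewrite scons_ord0.
rewrite mulr0 addr0; apply: eq_bigr => mu _; congr (_ * _).
rewrite /wedge1; under eq_bigr => i _ do rewrite dfun_snd_fst pullback_fst.
have := wedge1_dnx_vertical _ _ mu z.1 (fun i => (scons u v i).2.1)
  (fun i => (scons u v i).1).
rewrite scons_ord0 => -> //.
rewrite -[dnx mu 0 _]/(dnx mu z.1 _); congr (_ * dnx mu z.1 _).
exact: (congr1 (fun w j => (w j).1) (scons_skip0 _ _ u v)).
Qed.

Lemma smooth_cst (R : realType) (V W : normedModType R) (a : W) :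
  smooth (fun _ : V => a).
Proof.
move=> k; elim: k a => [|k IHk] a /=.
  by move=> x _; exact: cst_continuous.
split=> [x _|v]; first exact: differentiable_cst.
suff -> : (fun x => 'D_v (fun _ : V => a) x) = fun=> 0 by exact: IHk.
by apply/funext => x; exact: derive_cst.
Qed.

(** The same [df] serves at every point, so each directional derivative is constant. *)
Lemma smooth_affine (R : realType) (V W : normedModType R) (f df : V -> W) :
  (forall x, is_diff x f df) -> smooth f.
Proof.
move=> fdf [|k] /=.
  by move=> x _; apply: differentiable_continuous; have [] := fdf x.
split=> [x _|v]; first by have [] := fdf x.
suff -> : (fun x => 'D_v f x) = fun=> df v by exact: smooth_cst.
by apply/funext => x; have [fx <-] := fdf x; rewrite deriveE.
Qed.

(** The affine function with value [j.1] and gradient [j.2] works. It allows identities along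
    sections to be tested at arbitrary points of P_L. *)
Lemma jet_realization (R : realType) (n : nat) (j : fiber R n) :
  exists2 phi : base R n -> R, smooth phi & jet1 phi 0 = (0, j).
Proof.
pose l (y : base R n) := \sum_mu j.2 0 mu * y 0 mu.
have dl x : is_diff x (fun y => j.1 + l y) l.
  have -> : (fun y => j.1 + l y) =
      cst j.1 + \sum_mu (j.2 0 mu *: (fun y : base R n => y 0 mu)).
    by apply/funext => y; rewrite !fctE fct_sumE.
  have lE : l = 0 + \sum_mu (j.2 0 mu *: (fun y : base R n => y 0 mu)).
    by apply/funext => y; rewrite add0r fct_sumE.
  rewrite lE; apply: is_diffD.
  elim/big_ind : _ => [|f h df dh|mu _]; first exact: is_diff_cst.
    exact: is_diffD.
  by apply: is_diffZ; exact: is_diff_coord.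
exists (fun y => j.1 + l y); first exact: smooth_affine dl.
have l0 : l 0 = 0 by rewrite /l big1 // => mu _; rewrite mxE mulr0.
have lE mu : l (evec R mu) = j.2 0 mu.
  rewrite /l (bigD1 mu) //= big1; first by rewrite addr0 evecE eqxx mulr1.
  by move=> nu numu; rewrite evecE eq_sym (negPf numu) mulr0.
rewrite /jet1 l0 addr0 [j in RHS]surjective_pairing; congr (_, (_, _)).
by apply/rowP => mu; rewrite mxE; have [ld ldE] := dl 0; rewrite deriveE // ldE.
Qed.

(** The d^n x_mu have constant coefficients, so only [N mu] is differentiated, and [wedge1_dnx]
    evaluates dN^mu /\ d^n x_mu. *)
Lemma ext_d_flux (R : realType) (n : nat) (N : 'I_n.+1 -> base R n -> R)
    (x : base R n) v :
  (forall mu, differentiable (N mu) x) ->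
  ext_d (fun y w => \sum_mu N mu y * dnx mu y w) x v =
  (\sum_mu 'D_(evec R mu) (N mu) x) * @vol R n x v.
Proof.
move=> Nd.
have derive_flux u (c : 'I_n.+1 -> R) :
    'D_u (fun y => \sum_mu N mu y * c mu) x = \sum_mu 'd (N mu) x u * c mu.
  have -> : (fun y => \sum_mu N mu y * c mu) = \sum_mu (c mu *: N mu).
    apply/funext => y; rewrite fct_sumE; apply: eq_bigr => mu _.
    exact: mulrC.
  have Nder mu : derivable (N mu) x u by exact: diff_derivable.
  rewrite derive_sum => [|mu]; last exact: derivableZ.
  apply: eq_bigr => mu _; rewrite deriveZ // deriveE //.
  exact: mulrC.
rewrite /ext_d; under eq_bigr => i _.
  rewrite (derive_flux (v i) (fun mu => dnx mu x (fun j => v (lift i j)))).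
  rewrite mulr_sumr; over.
rewrite exchange_big /= mulr_suml; apply: eq_bigr => mu _.
rewrite deriveE // -wedge1_dnx; apply: eq_bigr => i _.
by rewrite mulrA.
Qed.

Section Momentum.
Context {R : realType} {n : nat} (L : fiber R n -> R).
Context {G : groupType} {g : lmodType R} (exp : g -> G) (eta : G -> R -> R).
Hypotheses (L_smooth : smooth L) (L_reg : regular L).
Hypotheses (exp_hom : exponential exp) (eta_act : smooth_action exp eta).

(** The Noether component N^mu = p^mu xi, as a function on the fiber. *)
Definition flux (xi : g) (mu : 'I_n.+1) (f : fiber R n) : R :=
  f.2 0 mu * genY exp eta xi f.1.

Lemma is_diff_flux xi mu f :
  is_diff f (flux xi mu) (fun v => f.2 0 mu * ('D_1 (genY exp eta xi) f.1 * v.1)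
    + genY exp eta xi f.1 * v.2 0 mu).
Proof.
have dy := genY_diff _ _ eta_act xi f.1.
have dy' := differentiableP dy.
have d1 := is_diff_comp (is_diff_snd _ _ f) (is_diff_coord _ mu f.2).
have d2 := is_diff_comp (is_diff_fst _ _ f) dy'.
apply: (is_diff_eq (is_diffM d1 d2)).
apply/funext => v; rewrite /= !fctE /=; congr (_ * _ + _).
rewrite deriveE // mulrC.
by rewrite -[in LHS](mulr1 v.1) -[v.1 * 1]/(v.1 *: (1 : R)) linearZ.
Qed.

(** The canonical lift covers the identity of X, so the curve defining the generator has constant
    base point; this makes [ThetaZ_vertical] applicable. *)
Lemma genZ_base xi (z : bundZ R n) : (genZ exp eta xi z).1 = 0.
Proof.
have cd := etaZ_curve_diff _ _ exp_hom eta_act _ xi z.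
rewrite /genZ deriveE // (diff_fst_near _ _ _ _ (fun=> z.1) 0) //.
by near=> t.
Unshelve. all: by end_near. Qed.

Lemma genZ_field xi (z : bundZ R n) :
  (genZ exp eta xi z).2.1 = genY exp eta xi z.2.1.
Proof.
have cd := etaZ_curve_diff _ _ exp_hom eta_act _ xi z.
have sd := diffable_snd _ _ (etaZ eta (exp ((0 : R) *: xi)) z).
have fd := diffable_fst _ _ (etaZ eta (exp ((0 : R) *: xi)) z).2.
have fsd : differentiable (fst \o snd) (etaZ eta (exp ((0 : R) *: xi)) z).
  exact: differentiable_comp.
have := derive_curve _ _ _ _ _ cd fsd.
rewrite diff_comp // diff_snd diff_fst /= => <-.
by [].
Qed.

Lemma JH_E xi z v : PL L z ->
  JH L exp eta xi z v =
  \sum_mu flux xi mu z.2 * dnx mu 0 (fun j => (v j).1).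
Proof.
move=> PLz; rewrite /JH /pullback /interior_prod ThetaZ_vertical ?genZ_base //.
rewrite inclZE // genZ_field /=; apply: eq_bigr => mu _.
rewrite mulrA; congr (_ * dnx _ _ _); apply/funext => j.
exact: diff_inclZ_base.
Qed.

Lemma noether_currentE xi (phi : base R n -> R) x v : smooth phi ->
  noether_current L exp eta xi phi x v =
  \sum_mu flux xi mu (jtilde L phi x).2 * dnx mu x v.
Proof.
move=> phi_smooth; rewrite /noether_current /pullback JH_E.
  2: exact: PL_legendre.
apply: eq_bigr => mu _; congr (_ * dnx _ _ _); apply/funext => j.
exact: diff_jtilde_base.
Qed.

Lemma flux_jtilde_diff xi mu (phi : base R n -> R) x : smooth phi ->
  differentiable (fun y => flux xi mu (jtilde L phi y).2) x.
Proof.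
move=> phi_smooth; apply: (differentiable_comp (f := snd \o jtilde L phi)).
  apply: differentiable_comp; [exact: jtilde_diff | exact: diffable_snd].
by have [] := is_diff_flux xi mu (jtilde L phi x).2.
Qed.

Lemma ext_d_noether_current xi (phi : base R n -> R) x v : smooth phi ->
  ext_d (noether_current L exp eta xi phi) x v =
  (\sum_mu 'D_(evec R mu) (fun y => flux xi mu (jtilde L phi y).2) x)
    * vol x v.
Proof.
move=> phi_smooth; rewrite -ext_d_flux.
  2: by move=> mu; exact: flux_jtilde_diff.
congr (ext_d _ _ _); apply/funext => y; apply/funext => w.
exact: noether_currentE.
Qed.

Hypothesis eta_gen : lifted_generator L exp eta.

(** Contracting dp^mu /\ dphi with (0, xi, - p^mu dxi/dphi) gives - p^mu (dxi/dphi) dphi - xi dp^mu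
    = - dN^mu. *)
Lemma momentum_mappingP P : momentum_mapping L exp eta P <->
  forall mu xi x f, PL L (x, f) ->
    is_diff f (P mu xi) (fun v => - 'd (flux xi mu) f v).
Proof.
have omegaE mu xi x f v : PL L (x, f) ->
    interior_prod (fun f' => (genP L exp eta xi (x, f')).2) (@omega R n mu) f v
    = - 'd (flux xi mu) f (v ord0).
  move=> PLf; rewrite /interior_prod /omega /wedge1.
  have -> : 'd (flux xi mu) f (v ord0) =
      f.2 0 mu * ('D_1 (genY exp eta xi) f.1 * (v ord0).1)
      + genY exp eta xi f.1 * (v ord0).2 0 mu.
    by have [_ ->] := is_diff_flux xi mu f.
  rewrite 2!big_ord_recl big_ord0 addr0 expr0 expr1 !mul1r.
  rewrite !dfun_snd_coord !dfun_fst.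
  rewrite !scons_ord0 !scons_lift0 eta_gen //= mxE.
  have -> : lift (lift ord0 ord0) ord0 = ord0 :> 'I_2 by exact: val_inj.
  by rewrite scons_ord0 /=; ring.
split=> [PP mu xi x f PLf|PP mu xi x f PLf].
  have [Pd PE] := PP mu xi x f PLf; apply: DiffDef => //.
  by apply/funext => v; rewrite -[LHS](PE (fun=> v)) omegaE.
have [Pd PE] := PP mu xi x f PLf; split=> // v.
by rewrite omegaE // /dfun PE.
Qed.

End Momentum.
(** * Invariance of the Hamiltonian and field equations *)

Section Invariance.
Context {R : realType} {n : nat} (L : fiber R n -> R).
Context {G : groupType} {g : lmodType R} (exp : g -> G) (eta : G -> R -> R).
Hypotheses (L_smooth : smooth L) (L_reg : regular L).
Hypotheses (exp_hom : exponential exp) (eta_act : smooth_action exp eta).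

Lemma etaP_PL a z : PL L (etaP L eta a z).
Proof. exact: PL_legendre. Qed.

Lemma etaP1 z : PL L z -> etaP L eta 1%g z = z.
Proof.
move=> PLz; rewrite /etaP (etaJ1_1 exp) //; exact: legendre_invK.
Qed.

(** The intermediate point is a Legendre image, where [legendre_inv] cancels, so the law is that of
    the prolonged action. *)
Lemma etaPM a b z : etaP L eta (a * b)%g z = etaP L eta a (etaP L eta b z).
Proof. by rewrite /etaP legendreK // (etaJ1M exp). Qed.

Lemma etaP_curve_diff (xi : g) z :
  differentiable (fun t : R => etaP L eta (exp (t *: xi)) z) 0.
Proof.
apply: (differentiable_comp (g := legendre L)
  (f := fun t : R => etaJ1 eta (exp (t *: xi)) (legendre_inv L z))).
  exact: etaJ1_curve_diff.
exact: legendre_diff.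
Qed.

(** Chain rule at time 0, where the orbit passes through [z]; it links [bridges_invariant] with the
    behavior of H along orbits. *)
Lemma is_diff_Ham_orbit (xi : g) z : PL L z ->
  is_diff (0 : R) (fun t : R => Ham L (etaP L eta (exp (t *: xi)) z))
    (fun s => s * 'd (Ham L) z (genP L exp eta xi z)).
Proof.
move=> PLz; have cd := etaP_curve_diff xi z.
have c0 : etaP L eta (exp ((0 : R) *: xi)) z = z.
  by rewrite (exp_scale0 _ exp_hom) etaP1.
have Hd : differentiable (Ham L) (etaP L eta (exp ((0 : R) *: xi)) z).
  by rewrite c0; exact: Ham_diff.
have Hcd := differentiable_comp cd Hd.
have := derive_curve _ _ _ _ _ cd Hd; rewrite c0 deriveE // => HcE.
apply: DiffDef => //; apply/funext => s; rewrite -HcE.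
by rewrite -[in LHS](mulr1 s) -[s * 1]/(s *: (1 : R)) linearZ.
Qed.

Lemma equivariant_Ham a z : ham_equivariant L eta -> PL L z ->
  Ham L (etaP L eta a z) = Ham L z.
Proof.
move=> Heq PLz; have := Heq a z PLz (@evec R n).
by rewrite /ham_density !vol_evec !mulr1.
Qed.

Lemma equivariant_bridges :
  ham_equivariant L eta -> bridges_invariant L exp eta.
Proof.
move=> Heq xi z PLz; have [_ dE] := is_diff_Ham_orbit xi _ PLz.
rewrite -[LHS]mul1r -[LHS](congr1 (@^~ 1) dE).
rewrite (_ : (fun t : R => _) = cst (Ham L z)) ?diff_cst //.
by apply/funext => t; rewrite equivariant_Ham.
Qed.

(** The one-parameter law turns the derivative at time [s] into one at time 0 along the orbit of
    [zs]. That point lies in P_L, so infinitesimal invariance applies there. *)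
Lemma bridges_orbit (xi : g) (t : R) z : bridges_invariant L exp eta ->
  PL L z -> Ham L (etaP L eta (exp (t *: xi)) z) = Ham L z.
Proof.
move=> Hinv PLz; pose h := fun t : R => Ham L (etaP L eta (exp (t *: xi)) z).
suff h_cst : forall s, is_diff s h (fun=> 0).
  have h0 : h 0 = Ham L z by rewrite /h (exp_scale0 _ exp_hom) etaP1.
  by rewrite -h0; exact (diff0_const _ h h_cst t 0).
move=> s.
pose zs := etaP L eta (exp (s *: xi)) z.
pose hs := fun t : R => Ham L (etaP L eta (exp (t *: xi)) zs).
have -> : h = hs \o (fun t => t - s).
  by apply/funext => r; rewrite /h /hs /= -etaPM -exp_hom subrK.
have sd : is_diff s (fun t : R => t - s) id.
  by apply: (is_diff_eq (is_diffB (is_diff_id s) (is_diff_cst s s)));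
    apply/funext => r; rewrite !fctE subr0.
have hd : is_diff (s - s) hs (fun=> 0).
  rewrite subrr; apply: (is_diff_eq (is_diff_Ham_orbit xi _ (etaP_PL _ _))).
  by apply/funext => r; rewrite Hinv ?mulr0 //; exact: etaP_PL.
exact: is_diff_comp sd hd.
Qed.

End Invariance.

(** * Hamilton equations and the divergence of the Noether current *)

Section FieldEquations.
Context {R : realType} {n : nat} (L : fiber R n -> R).
Hypotheses (L_smooth : smooth L) (L_reg : regular L).

(** The value of dphi /\ d^n x_mu on [v]; the base point 0 is arbitrary, since d^n x_mu has constant
    coefficients. *)
Definition dphi_dnx (mu : 'I_n.+1) (v : 'I_n.+1 -> total R n) : R :=
  \sum_(i < n.+1) (-1) ^+ i * (v i).2.1 * dnx mu 0 (fun j => (v (lift i j)).1).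

Lemma ThetaH_E z v : ThetaH L z v =
  \sum_mu z.2.2 0 mu * dphi_dnx mu v - Ham L z * @vol R n 0 (fun i => (v i).1).
Proof.
rewrite /ThetaH pullback_fst; congr (_ - _); apply: eq_bigr => mu _.
congr (_ * _); apply: eq_bigr => i _.
by rewrite dfun_snd_fst pullback_fst.
Qed.

Lemma derive_ThetaH z u v : PL L z ->
  'D_u (fun y => ThetaH L y v) z =
  \sum_mu u.2.2 0 mu * dphi_dnx mu v
  - 'd (Ham L) z u * @vol R n 0 (fun i => (v i).1).
Proof.
move=> PLz; have Hd := Ham_diff _ L_smooth L_reg _ PLz.
have pd mu : is_diff z (fun y : total R n => y.2.2 0 mu) (fun y => y.2.2 0 mu).
  exact: is_diff_comp (is_diff_comp (is_diff_snd _ _ z) (is_diff_snd _ _ z.2))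
    (is_diff_coord _ mu z.2.2).
set V := vol _ _.
have -> : (fun y => ThetaH L y v) =
    \sum_mu (dphi_dnx mu v *: (fun y : total R n => y.2.2 0 mu)) - V *: Ham L.
  apply/funext => y; rewrite ThetaH_E !fctE fct_sumE; congr (_ - _).
    by apply: eq_bigr => mu _; exact: mulrC.
  exact: mulrC.
have pder mu : derivable (fun y : total R n => y.2.2 0 mu) z u.
  by apply: diff_derivable; have [] := pd mu.
have Hder : derivable (Ham L) z u by exact: diff_derivable.
rewrite deriveB; last exact: derivableZ; last first.
  by apply: derivable_sum => mu; exact: derivableZ.
rewrite derive_sum => [|mu]; last exact: derivableZ.
rewrite deriveZ // deriveE //; congr (_ - _); last exact: mulrC.
apply: eq_bigr => mu _; rewrite deriveZ // deriveE; last by have [] := pd mu.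
by have [_ ->] := pd mu; exact: mulrC.
Qed.

(** The first slot contributes the derivative along [u]. In the other terms [u] remains an argument
    of the form: being vertical, it removes the volume term and leaves [u.2.1] times d^n x_mu. *)
Lemma ext_d_ThetaH_vertical z u w : PL L z -> u.1 = 0 ->
  ext_d (ThetaH L) z (scons u w) =
  \sum_mu u.2.2 0 mu * dphi_dnx mu w
  - 'd (Ham L) z u * @vol R n 0 (fun i => (w i).1)
  - u.2.1 * \sum_mu \sum_(i < n.+1)
      (-1) ^+ i * (w i).2.2 0 mu * dnx mu 0 (fun j => (w (lift i j)).1).
Proof.
move=> PLz u0; rewrite /ext_d big_ord_recl expr0 mul1r scons_ord0 scons_skip0.
rewrite derive_ThetaH //; congr (_ + _).
rewrite exchange_big mulr_sumr -sumrN; apply: eq_bigr => i _.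
rewrite scons_skip scons_lift0 derive_ThetaH //.
rewrite (@vol_eq0 _ _ _ _ ord0) ?mulr0 ?subr0; last by rewrite scons_ord0.
(* Entry [i] of [w] sits in slot i + 1, whence the extra minus sign. *)
rewrite lift0 exprS mulN1r mulNr !mulr_sumr; congr (- _).
apply: eq_bigr => mu _; rewrite /dphi_dnx.
have := wedge1_dnx_vertical _ _ mu 0
  (fun k => (scons u (fun j => w (lift i j)) k).2.1)
  (fun k => (scons u (fun j => w (lift i j)) k).1).
rewrite scons_ord0 => -> //.
have -> : (fun j => (scons u (fun j => w (lift i j)) (lift ord0 j)).1) =
    (fun j => (w (lift i j)).1).
  exact: (congr1 (fun w j => (w j).1) (scons_skip0 _ _ u _)).
by ring.
Qed.

Lemma is_diff_jtilde_momentum (phi : base R n -> R) mu x : smooth phi ->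
  is_diff x (fun y => (jtilde L phi y).2.2 0 mu)
    (fun v => ('d (jtilde L phi) x v).2.2 0 mu).
Proof.
move=> phi_smooth.
have jd := differentiableP (jtilde_diff _ L_reg _ x phi_smooth).
pose z := jtilde L phi x.
exact: is_diff_comp (is_diff_comp (is_diff_comp jd (is_diff_snd _ _ z))
  (is_diff_snd _ _ z.2)) (is_diff_coord _ mu z.2.2).
Qed.

(* The Hamilton equations dphi/dx^mu = dH/dp^mu and dp^mu/dx^mu = - dH/dphi,
   paired with the vertical vector (0, a, b). *)
Lemma hamilton_equations (phi : base R n -> R) x a (b : base R n) :
  smooth phi -> hamiltonian_section L phi ->
  \sum_mu b 0 mu * 'd phi x (evec R mu)
  - a * \sum_mu 'D_(evec R mu) (fun y => (jtilde L phi y).2.2 0 mu) x =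
  'd (Ham L) (jtilde L phi x) (0, (a, b)).
Proof.
move=> phi_smooth phi_ham.
pose w i := 'd (jtilde L phi) x (evec R i).
have w1 i : (w i).1 = evec R i by exact: diff_jtilde_base.
have w21 i : (w i).2.1 = 'd phi x (evec R i) by exact: diff_jtilde_field.
have volw : @vol R n 0 (fun i => (w i).1) = 1.
  by rewrite -(vol_evec R n 0); congr (vol _ _); apply/funext.
have dnxw mu i : dnx mu 0 (fun j => (w (lift i j)).1) =
    dnx mu 0 (fun j => evec R (lift i j)).
  by congr (dnx _ _ _); apply/funext.
have dphi_dnxE mu : dphi_dnx mu w = 'd phi x (evec R mu).
  rewrite /dphi_dnx; under eq_bigr => i _ do rewrite w21 dnxw.
  by rewrite wedge1_dnx vol_evec mulr1.
have divE mu : \sum_(i < n.+1) (-1) ^+ i * (w i).2.2 0 mu *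
    dnx mu 0 (fun j => (w (lift i j)).1) =
    'D_(evec R mu) (fun y => (jtilde L phi y).2.2 0 mu) x.
  have [pd pE] := is_diff_jtilde_momentum _ mu x phi_smooth.
  have wp i : (w i).2.2 0 mu =
      'd (fun y => (jtilde L phi y).2.2 0 mu) x (evec R i) by rewrite pE.
  under eq_bigr => i _ do rewrite wp dnxw.
  by rewrite wedge1_dnx vol_evec mulr1 deriveE.
(* Contraction with a constant vertical field, evaluated on the coordinate frame, whose volume is
   1. *)
have := phi_ham (fun=> (0, (a, b))) x (@evec R n).
rewrite /pullback /interior_prod /OmegaH -/w.
rewrite ext_d_ThetaH_vertical //; last first.
  exact: PL_legendre.
rewrite volw mulr1 /=; under eq_bigr => mu _ do rewrite dphi_dnxE.
under [in X in _ * X]eq_bigr => mu _ do rewrite divE.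
by move=> /eqP; rewrite oppr_eq0 addrAC subr_eq0 => /eqP.
Qed.

(** By the product rule, div N = xi div p + p^mu (dxi/dphi) phi_mu. This is the opposite of the left
    side of the Hamilton equations for a = xi and b = - p dxi/dphi, whose right side is dH(xi_P) =
    0. *)
Lemma noether_divergence (G : groupType) (g : lmodType R) (exp : g -> G)
    (eta : G -> R -> R) (xi : g) (phi : base R n -> R) x :
  smooth_action exp eta -> lifted_generator L exp eta ->
  bridges_invariant L exp eta ->
  smooth phi -> hamiltonian_section L phi ->
  \sum_mu 'D_(evec R mu) (fun y => flux exp eta xi mu (jtilde L phi y).2) x = 0.
Proof.
move=> eta_act eta_gen Hinv phi_smooth phi_ham.
set z := jtilde L phi x; have PLz : PL L z by exact: PL_legendre.
have jd := differentiableP (jtilde_diff _ L_reg _ x phi_smooth).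
have := Hinv xi z PLz; rewrite eta_gen // -hamilton_equations //.
move/eqP; rewrite -oppr_eq0 opprB => /eqP; apply: etrans.
rewrite mulr_sumr -sumrB; apply: eq_bigr => mu _.
have fd := is_diff_comp (is_diff_comp jd (is_diff_snd _ _ z))
  (is_diff_flux exp eta eta_act xi mu z.2).
have /= := is_diff_derive _ _ _ _ _ (evec R mu) fd.
rewrite -/z diff_jtilde_field // => E.
have pd := is_diff_jtilde_momentum _ mu x phi_smooth.
rewrite (is_diff_derive _ _ _ _ _ (evec R mu) pd) [RHS]/= mxE.
by apply: etrans E _; ring.
Qed.

End FieldEquations.

(** * Momentum mappings compared with the components of the current *)

Lemma momentum_mapping_components (R : realType) (n : nat) (L : fiber R n -> R)
    (G : groupType) (g : lmodType R) (exp : g -> G) (eta : G -> R -> R) P :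
  smooth L -> regular L -> exponential exp -> smooth_action exp eta ->
  lifted_generator L exp eta ->
  momentum_mapping L exp eta P <->
  forall xi : g, exists c : 'I_n.+1 -> R,
    noether_components L exp eta xi (fun mu f => c mu - P mu xi f).
Proof.
move=> L_smooth L_reg exp_hom eta_act eta_gen.
rewrite (momentum_mappingP _ _ _ eta_act eta_gen).
split=> [PP xi|PN mu xi x f PLf].
  (* The Legendre map acts on fibers independently of the base point, so [leg] covers the fiber of
     P_L and pulls P^mu + N^mu back to a function on all of R^{n+2}. *)
  pose leg (j : fiber R n) := (legendre L (0, j)).2.
  pose Q mu (j : fiber R n) := P mu xi (leg j) + flux exp eta xi mu (leg j).
  have legd j : is_diff j leg ('d leg j).
    apply: differentiableP; apply: (differentiable_comp (g := snd)).
      apply: (differentiable_comp (g := legendre L)).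
        exact: differentiable_pair.
      exact: legendre_diff.
    exact: diffable_snd.
  have Q_cst mu j : is_diff j (Q mu) (fun=> 0).
    have PLj : PL L (0, leg j) by exists (0, j).
    have [fd _] := is_diff_flux exp eta eta_act xi mu (leg j).
    have Pd := PP mu xi 0 (leg j) PLj.
    apply: (is_diff_eq (is_diff_comp (legd j)
      (is_diffD Pd (differentiableP fd)))).
    by apply/funext => v; rewrite /= !fctE addNr.
  (* The constant is the value of P^mu + N^mu at the image of the zero jet. *)
  exists (fun mu => Q mu 0) => phi phi_smooth x v.
  rewrite noether_currentE //; apply: eq_bigr => mu _; congr (_ * _).
  rewrite (diff0_const _ _ (Q_cst mu) 0 (jet1 phi x).2) /Q.
  by rewrite -[leg _]/(jtilde L phi x).2 addrAC subrr add0r.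
have [c cN] := PN xi.
have PE h : PL L (x, h) -> P mu xi h = c mu - flux exp eta xi mu h.
  move=> [j _ /(congr1 snd) /= jh].
  (* An affine section passes through [h] over the origin; there the independence of the d^n x_mu
     isolates each component of the current. *)
  have [phi phi_smooth phij] := jet_realization R n j.2.
  have jE : (jtilde L phi 0).2 = h by rewrite /jtilde phij -jh.
  have := dnx_free _ _ 0 (fun mu => (c mu - P mu xi h) - flux exp eta xi mu h).
  move=> /(_ _ mu)/eqP; rewrite subr_eq0 => H.
  have /eqP <- : c mu - P mu xi h == flux exp eta xi mu h.
    apply: H => v; under eq_bigr => nu _ do rewrite mulrBl.
    rewrite sumrB -jE -noether_currentE // -cN //.
    exact: subrr.
  by rewrite opprB addrC subrK.
have [fd _] := is_diff_flux exp eta eta_act xi mu f.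
(* The formula for P^mu is known only over P_L; openness extends it to a neighborhood of [f], as
   differentiation requires. *)
have near_f : \near f, c mu - flux exp eta xi mu f = P mu xi f.
  have nearPL : \forall h \near f, PL L (x, h).
    have pc : {for f, continuous (fun h : fiber R n => (x, h))}.
      by apply: differentiable_continuous; exact: differentiable_pair.
    exact: pc (PL_near _ L_reg _ PLf).
  by near=> h; rewrite PE //; near: h.
apply: (near_eq_is_diff _ _ _ _ _ _ near_f).
apply: (is_diff_eq (is_diffB (is_diff_cst (c mu) f) (differentiableP fd))).
by apply/funext => v; rewrite !fctE sub0r.
Unshelve. all: by end_near. Qed.

(** The contraction prescribes only dP^mu, and dP^mu = - dN^mu; hence the components have the form
    [c mu - P mu xi f]. Neither the sign nor the constants affect the vanishing of the
    divergence. *)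
Theorem proposition6p2 (R : realType) (n : nat) (L : fiber R n -> R)
    (G : groupType) (g : lmodType R) (exp : g -> G) (eta : G -> R -> R)
    (L_smooth : smooth L) (L_regular : regular L)
    (exp_hom : exponential exp) (eta_act : smooth_action exp eta)
    (eta_gen : lifted_generator L exp eta) :
  [/\ exists P, momentum_mapping L exp eta P,
      forall P, momentum_mapping L exp eta P <->
        forall xi : g, exists c : 'I_n.+1 -> R,
          noether_components L exp eta xi (fun mu f => c mu - P mu xi f),
      forall P, momentum_mapping L exp eta P ->
        forall (xi : g) (phi : base R n -> R), smooth phi ->
        forall x v, ext_d (noether_current L exp eta xi phi) x v =
          - momentum_divergence L P xi phi x * @vol R n x v,
      (ham_equivariant L eta -> bridges_invariant L exp eta) /\
      (bridges_invariant L exp eta ->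
        forall (xi : g) (t : R) z, PL L z ->
          Ham L (etaP L eta (exp (t *: xi)) z) = Ham L z)
    & ham_equivariant L eta -> ham_nowhere_locally_constant L ->
      forall (xi : g) (phi : base R n -> R), smooth phi ->
        hamiltonian_section L phi ->
        (forall x v, ext_d (noether_current L exp eta xi phi) x v = 0) /\
        (forall P, momentum_mapping L exp eta P ->
          forall x, momentum_divergence L P xi phi x = 0)].
Proof.
have current_div P : momentum_mapping L exp eta P ->
    forall (xi : g) (phi : base R n -> R), smooth phi ->
    forall x v, ext_d (noether_current L exp eta xi phi) x v =
      - momentum_divergence L P xi phi x * @vol R n x v.
  move=> /(momentum_mappingP _ _ _ eta_act eta_gen) PP xi phi phi_smooth x v.
  rewrite ext_d_noether_current //; congr (_ * _).
  rewrite /momentum_divergence -sumrN; apply: eq_bigr => mu _.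
  have jd : differentiable (fun y => (jtilde L phi y).2) x.
    apply: (differentiable_comp (g := snd)); first exact: jtilde_diff.
    exact: diffable_snd.
  have jd' := differentiableP jd.
  have [fd _] := is_diff_flux exp eta eta_act xi mu (jtilde L phi x).2.
  have [fjd fjE] := is_diff_comp jd' (differentiableP fd).
  have PLx : PL L (x, (jtilde L phi x).2) by exists (jet1 phi x).
  (* Since dP^mu = - dN^mu on P_L, composition with the section gives opposite derivatives. *)
  have [Pjd PjE] := is_diff_comp jd' (PP mu xi _ _ PLx).
  pose j2 y := (jtilde L phi y).2.
  rewrite -[fun y => flux _ _ _ _ _]/(flux exp eta xi mu \o j2).
  rewrite -[fun y => P _ _ _]/(P mu xi \o j2).
  by rewrite !deriveE // fjE PjE /= opprK.
split=> //.
(* The contraction equals - dN^mu, so - N^mu is a momentum mapping. *)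
- exists (fun mu xi f => - flux exp eta xi mu f).
  apply/(momentum_mappingP _ _ _ eta_act eta_gen) => mu xi x f PLf.
  have [fd _] := is_diff_flux exp eta eta_act xi mu f.
  exact: is_diffN (differentiableP fd).
- by move=> P; exact: momentum_mapping_components.
- split=> [Heq|Hinv xi t z PLz]; first exact: equivariant_bridges.
  exact: bridges_orbit.
move=> Heq _ xi phi phi_smooth phi_ham.
have current0 x v : ext_d (noether_current L exp eta xi phi) x v = 0.
  rewrite ext_d_noether_current // noether_divergence ?mul0r //.
  exact: equivariant_bridges.
(* Evaluation on the coordinate frame, of volume 1, recovers the divergence from the form. *)
split=> // P PP x; have := current_div P PP xi phi phi_smooth x (@evec R n).
by rewrite current0 vol_evec mulr1 => /esym/eqP; rewrite oppr_eq0 => /eqP.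
Qed.
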